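(* There exist constants $\tilde{D}_1,\tilde{D}_2>1$, independent of $\lambda$, such that for every $\lambda>2\pi^2$ the following holds. Let $N$, $A_0$, $B_0$, $K$ be the integer and matrices associated with $\lambda$ as defined in the context, let $F=A_0+B_0K$, and let $P$ be the (positive definite) solution of the Lyapunov equation $$F^\top P+PF+2\lambda P=-I.$$ Then $$\sigma_{\max}(P)\le e^{\tilde{D}_1\sqrt{\lambda}\ln\lambda},\qquad \sigma_{\min}(P)\ge e^{-\tilde{D}_2\sqrt{\lambda}\ln\lambda}.$$
   Context: Given $\lambda>2\pi^2$: - $N=\lfloor \sqrt{2\lambda+1}/\pi\rfloor$ and $\lambda_n=(n\pi)^2$ for $n\ge1$. - $A_0=\mathrm{diag}\left(1-\frac{\pi^2}{4},\,1-\lambda_1,\dots,1-\lambda_N\right)\in\mathbb{R}^{(N+1)\times(N+1)}$. - $B_0=(1,b_1,\dots,b_N)^\top\in\mathbb{R}^{N+1}$ with $b_n=-\frac{4\sqrt{2}\,n}{(4n^2-1)\pi}$. - $\hat\lambda_n=-3\lambda-\frac{\lfloor\lambda\rfloor}{N}n$ for $n=0,1,\dots,N$. - $K\in\mathbb{R}^{1\times(N+1)}$ is the row vector for which the characteristic polynomial of $A_0+B_0K$ is $\prod_{n=0}^N(z-\hat\lambda_n)$, given by Ackermann's formula $$K=-e_{N+1}^\top\,\mathcal{C}(A_0,B_0)^{-1}\prod_{n=0}^N(A_0-\hat\lambda_nI),$$ where $e_{N+1}^\top=(0,\dots,0,1)$ and $\mathcal{C}(A_0,B_0)=[B_0,A_0B_0,\dots,A_0^NB_0]$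 (which is invertible). $\sigma_{\max}(P)$ and $\sigma_{\min}(P)$ denote the largest and smallest singular values (equivalently, eigenvalues) of $P$. *)

(* Defs.v *)
From mathcomp Require Import all_boot all_order all_algebra.
From mathcomp Require Import all_classical all_reals all_analysis.

Set Implicit Arguments.
Unset Strict Implicit.
Unset Printing Implicit Defensive.

Import Order.TTheory GRing.Theory Num.Theory.
Local Open Scope classical_set_scope.
Local Open Scope ring_scope.

Section MatrixNotions.
Variable R : realType.

Definition controllability_mx (n : nat) (A : 'M[R]_n.+1) (B : 'cV[R]_n.+1) :
    'M[R]_n.+1 :=
  \matrix_(i, j) (A ^+ j *m B) i 0.

(* Ackermann's formula, with the sign that makes [A + B *m K] (rather than
   [A - B *m K]) have the characteristic polynomial
   [\prod_(i < n.+1) ('X - (mu i)%:P)]; it is meaningful when the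
   controllability matrix is invertible. *)
Definition ackermann (n : nat) (A : 'M[R]_n.+1) (B : 'cV[R]_n.+1)
    (mu : nat -> R) : 'rV[R]_n.+1 :=
  - (delta_mx 0 ord_max *m invmx (controllability_mx A B)
     *m \prod_(i < n.+1) (A - (mu i)%:M)).

Definition posdefmx (n : nat) (P : 'M[R]_n) : Prop :=
  P^T = P /\ forall x : 'cV[R]_n, x != 0 -> 0 < (x^T *m P *m x) 0 0.

Definition singular_values (n : nat) (P : 'M[R]_n) : set R :=
  [set s | 0 <= s /\ eigenvalue (P^T *m P) (s ^+ 2)].

(* The set of singular values is finite, and nonempty when 0 < n, so these
   [sup] and [inf] are attained. *)
Definition sigma_max (n : nat) (P : 'M[R]_n) : R := sup (singular_values P).
Definition sigma_min (n : nat) (P : 'M[R]_n) : R := inf (singular_values P).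

Definition shifted_lyapunov (n : nat) (F : 'M[R]_n) (lambda : R)
    (P : 'M[R]_n) : Prop :=
  F^T *m P + P *m F + (2 * lambda) *: P = - 1%:M.

End MatrixNotions.

Section Truncation.
Variables (R : realType) (lambda : R).

Definition dimN : nat := Num.truncn (Num.sqrt (2 * lambda + 1) / pi).

Definition lam (n : nat) : R := (n%:R * pi) ^+ 2.

Definition bcoef (n : nat) : R :=
  - (4 * Num.sqrt 2 * n%:R) / ((4 * n%:R ^+ 2 - 1) * pi).

Definition A0 : 'M[R]_dimN.+1 :=
  diag_mx (\row_(n < dimN.+1)
    if n == 0%N :> nat then 1 - pi ^+ 2 / 4 else 1 - lam n).

Definition B0 : 'cV[R]_dimN.+1 :=
  \col_(n < dimN.+1) if n == 0%N :> nat then 1 else bcoef n.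

Definition lamhat (n : nat) : R :=
  - 3 * lambda - (Num.floor lambda)%:~R / dimN%:R * n%:R.

Definition K0 : 'rV[R]_dimN.+1 := ackermann A0 B0 lamhat.

Definition F0 : 'M[R]_dimN.+1 := A0 + B0 *m K0.

End Truncation.

(* Main.v *)
Require Import Defs.
From mathcomp Require Import all_boot all_order all_algebra.
From mathcomp Require Import all_classical all_reals all_analysis.
From mathcomp Require Import complex ring lra zify.

(* The vectors [v_j = (mu_j - A)^-1 B] are eigenvectors of [F = A + B K] with
   eigenvalues [mu_j], since Ackermann's row satisfies [K v_j = 1]; hence [F] is
   diagonalised by [V_ij = b_i / (mu_j - a_i)], a row-scaled Cauchy matrix whose
   inverse [W] is explicit by Lagrange interpolation.  In this eigenbasis the
   Lyapunov equation decouples: [P = W^T Q W] where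
   [Q_ij = - (V^T V)_ij / (mu_i + mu_j + 2 lambda)], and [Q] is a sum of squares
   because the Cauchy kernel [1 / (m_i + m_j)] is.
   Since the [a_i], the [mu_j] and the two families from each other are at
   distance at least 1 and at most [5 lambda], the entries of [V] are at most 1
   in modulus and those of [W] at most [(5 lambda)^(2N+3)], where
   [N <= sqrt lambda].  This bounds the entries of [P] and [F]; the entries of
   [P] control its largest eigenvalue, and testing the Lyapunov equation on an
   eigenvector of [P] gives [s >= 1 / (2 (N+1) max |F_ij|)] for every
   eigenvalue [s]. *)

Set Implicit Arguments.
Unset Strict Implicit.
Unset Printing Implicit Defensive.

Import Order.TTheory GRing.Theory Num.Theory.
Local Open Scope classical_set_scope.
Local Open Scope ring_scope.

(** * Cauchy matrices and Ackermann's formula *)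

Section Cauchy.
Variables (K : fieldType) (n : nat) (a mu b : nat -> K).
Hypotheses (a_inj : injective a) (mu_inj : injective mu).
Hypothesis mu_neq_a : forall i j : 'I_n.+1, mu j != a i.
Hypothesis b_neq0 : forall i : 'I_n.+1, b i != 0.

Definition cauchy_mx : 'M[K]_n.+1 := \matrix_(i, j) (b i / (mu j - a i)).

(** The middle product is the value at [a i] of the [j]-th Lagrange basis polynomial for the nodes
    [mu]. *)
Definition cauchy_inv : 'M[K]_n.+1 :=
  \matrix_(j, i) ((\prod_(k < n.+1) (mu j - a k))
    * (\prod_(l < n.+1 | l != j) ((a i - mu l) / (mu j - mu l)))
    / (\prod_(k < n.+1 | k != i) (a i - a k)) / b i).

Lemma horner_lagrange (x : nat -> K) (i : 'I_n.+1) (z : K) : injective x ->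
  (tnth (lagrange n.+1 x) i).[z]
    = \prod_(k < n.+1 | k != i) ((z - x k) / (x i - x k)).
Proof.
move=> x_inj; rewrite lagrangeE // hornerM hornerC !horner_prod.
rewrite big_split /= mulrC prodfV; congr (_ * _^-1).
  by apply: eq_bigr => k _; rewrite hornerXsubC.
by apply: eq_bigr => k _; rewrite hornerXsubC.
Qed.

(** This is Lagrange interpolation of [g] at the nodes [a], divided by the nodal polynomial; the
    size bound makes the interpolation exact. *)
Lemma partial_fraction (g : {poly K}) (z : K) : (size g <= n.+1)%N ->
  (forall i : 'I_n.+1, z != a i) ->
  \sum_(i < n.+1) g.[a i] / (\prod_(k < n.+1 | k != i) (a i - a k)) / (z - a i)
    = g.[z] / \prod_(k < n.+1) (z - a k).
Proof.
move=> sg za.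
rewrite [in RHS](lagrange_gen (ltn0Sn n) a_inj sg) horner_sum mulr_suml.
apply: eq_bigr => i _; rewrite hornerM hornerC horner_lagrange // big_split /=.
rewrite prodfV [X in _ = _ / X](bigD1 i) //=.
set p := \prod_(k < _ | _) (z - a k); set q := \prod_(k < _ | _) (a i - a k).
have p0 : p != 0 by apply/prodf_neq0 => k _; rewrite subr_eq0.
have z0 : z - a i != 0 by rewrite subr_eq0.
have q0 : q != 0.
  apply/prodf_neq0 => k ki; rewrite subr_eq0 inj_eq //.
  by rewrite eq_sym.
by field; rewrite p0 z0 q0.
Qed.

(** Up to the factor [q], entry [(j, l)] is the partial fraction sum of the [j]-th Lagrange basis
    polynomial [g] of the nodes [mu], taken at [mu l], where [g] is 1 if [j = l] and 0 otherwise. *)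
Lemma cauchy_invV : cauchy_inv *m cauchy_mx = 1%:M.
Proof.
apply/matrixP => j l; rewrite !mxE.
pose g := tnth (lagrange n.+1 mu) j.
pose q := \prod_(k < n.+1) (mu j - a k).
transitivity (q * \sum_(i < n.+1) g.[a i]
    / (\prod_(k < n.+1 | k != i) (a i - a k)) / (mu l - a i)).
  rewrite mulr_sumr; apply: eq_bigr => i _; rewrite !mxE -/q horner_lagrange //.
  set r := \prod_(k < _ | _) _; set s := \prod_(k < _ | _) _.
  have b0 := b_neq0 i.
  have z0 : mu l - a i != 0 by rewrite subr_eq0.
  have s0 : s != 0.
    apply/prodf_neq0 => k ki; rewrite subr_eq0 inj_eq //.
    by rewrite eq_sym.
  by field; rewrite b0 z0 s0.
rewrite partial_fraction //.
rewrite lagrange_sample //; have [<-|_] := eqVneq j l; last first.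
  by rewrite mul0r mulr0.
rewrite mul1r divff //.
by apply/prodf_neq0 => k _; rewrite subr_eq0.
Qed.

Lemma cauchy_mxV : cauchy_mx *m cauchy_inv = 1%:M.
Proof. exact/mulmx1C/cauchy_invV. Qed.

End Cauchy.

Section PolePlacement.
Variables (R : realType) (n : nat) (a mu b : nat -> R).
Hypotheses (a_inj : injective a) (mu_inj : injective mu).
Hypothesis mu_neq_a : forall i j : 'I_n.+1, mu j != a i.
Hypothesis b_neq0 : forall i : 'I_n.+1, b i != 0.

Let A : 'M[R]_n.+1 := diag_mx (\row_i a i).
Let B : 'cV[R]_n.+1 := \col_i b i.
Let V := cauchy_mx n a mu b.

Lemma controllability_diagE :
  controllability_mx A B = \matrix_(i, j) (a i ^+ j * b i).
Proof.
apply/matrixP => i j; rewrite [LHS]mxE.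
have -> : A ^+ j = horner_mx A 'X^j by rewrite rmorphXn /= horner_mx_X.
rewrite horner_mx_diag mul_diag_mx !mxE.
by rewrite hornerXn.
Qed.

(** A row-scaled transposed Vandermonde matrix; hence the [invmx] in [ackermann] is a genuine
    inverse. *)
Lemma controllability_diag_unit : controllability_mx A B \in unitmx.
Proof.
have -> : controllability_mx A B
    = diag_mx (\row_i b i) *m (Vandermonde n.+1 (\row_i a i))^T.
  rewrite controllability_diagE; apply/matrixP => i j.
  by rewrite mul_diag_mx !mxE mulrC.
rewrite unitmx_mul unitmx_tr !unitmxE det_diag det_Vandermonde !unitfE.
apply/andP; split; apply/prodf_neq0 => i _; first by rewrite mxE.
apply/prodf_neq0 => j ij; rewrite !mxE subr_eq0 inj_eq //.
by rewrite neq_ltn ij orbT.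
Qed.

(* [p(A)] sends column [j] of [V] to [- q_j(A) B] with
   [q_j = \prod_(i != j) ('X - mu_i)] monic of degree [n], and the last row of
   the inverse controllability matrix reads off the leading coefficient. *)
Lemma ackermann_cauchy : ackermann A B mu *m V = const_mx 1.
Proof.
pose q (j : 'I_n.+1) : {poly R} := \prod_(i < n.+1 | i != j) ('X - (mu i)%:P).
have sq j : size (q j) = n.+1.
  by rewrite /q -big_filter size_prod_XsubC -[LHS]/(size _).+1
    -sum1_size big_filter sum1_card cardC1 card_ord.
have qmon j : q j \is monic by apply: monic_prod_XsubC.
have pA : \prod_(i < n.+1) (A - (mu i)%:M) *m V
    = - (controllability_mx A B *m \matrix_(k, j) (q j)`_k).
  have -> : \prod_(i < n.+1) (A - (mu i)%:M)
      = horner_mx A (\prod_(i < n.+1) ('X - (mu i)%:P)).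
    rewrite rmorph_prod; apply: eq_bigr => i _.
    by rewrite rmorphB /= horner_mx_X horner_mx_C.
  rewrite controllability_diagE horner_mx_diag mul_diag_mx.
  apply/matrixP => i j; rewrite !mxE.
  rewrite (bigD1 j) //= -/(q j) hornerM hornerXsubC.
  transitivity (- (b i * (q j).[a i])).
    have := mu_neq_a i j; rewrite -subr_eq0 => h; field; exact: h.
  congr (- _); rewrite (@horner_coef_wide _ n.+1) ?sq // mulr_sumr.
  by apply: eq_bigr => k _; rewrite !mxE; ring.
rewrite /ackermann mulNmx -(mulmxA _ _ V) pA mulmxN opprK -(mulmxA _ (invmx _)).
rewrite mulKmx ?controllability_diag_unit //.
apply/matrixP => i j; rewrite ord1 -rowE !mxE /=.
by have /monicP := qmon j; rewrite lead_coefE sq.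
Qed.

(** Since [K V] is the all-ones row, [(A + B K) V = V diag(mu)] reads entrywise
    [a_i v + b_i = mu_j v] with [v = b_i / (mu_j - a_i)]. *)
Lemma ackermann_diagonalises :
  A + B *m ackermann A B mu
    = V *m diag_mx (\row_i mu i) *m cauchy_inv n a mu b.
Proof.
suff FV : (A + B *m ackermann A B mu) *m V = V *m diag_mx (\row_i mu i).
  by rewrite -FV -mulmxA cauchy_mxV // mulmx1.
rewrite mulmxDl -mulmxA ackermann_cauchy mul_diag_mx mul_mx_diag.
apply/matrixP => i j; rewrite !mxE big_ord_recl big_ord0 !mxE.
have := mu_neq_a i j; rewrite -subr_eq0 => h; field; exact: h.
Qed.

End PolePlacement.

(** * Singular values of positive definite matrices *)

Section SingularValues.
Variables (R : realType) (n : nat).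

Definition dotc (x y : 'cV[R]_n.+1) : R := (x^T *m y) 0 0.

Lemma dotcE (x y : 'cV[R]_n.+1) : dotc x y = \sum_i x i 0 * y i 0.
Proof. by rewrite /dotc mxE; apply: eq_bigr => i _; rewrite mxE. Qed.

Lemma dotcC (x y : 'cV[R]_n.+1) : dotc x y = dotc y x.
Proof. by rewrite !dotcE; apply: eq_bigr => i _; rewrite mulrC. Qed.

Lemma dotcDr (x y z : 'cV[R]_n.+1) : dotc x (y + z) = dotc x y + dotc x z.
Proof. by rewrite /dotc mulmxDr mxE. Qed.

Lemma dotcZr (x y : 'cV[R]_n.+1) (c : R) : dotc x (c *: y) = c * dotc x y.
Proof. by rewrite /dotc -scalemxAr mxE. Qed.

Lemma dotcBr (x y z : 'cV[R]_n.+1) : dotc x (y - z) = dotc x y - dotc x z.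
Proof. by rewrite dotcDr -scaleN1r dotcZr mulN1r. Qed.

Lemma dotc_mulmxr (A : 'M[R]_n.+1) (x y : 'cV[R]_n.+1) :
  dotc x (A *m y) = dotc (A^T *m x) y.
Proof. by rewrite /dotc trmx_mul trmxK mulmxA. Qed.

Lemma dotc_ge0 (x : 'cV[R]_n.+1) : 0 <= dotc x x.
Proof. by rewrite dotcE; apply: sumr_ge0 => i _; rewrite -expr2 sqr_ge0. Qed.

Lemma dotc_gt0 (x : 'cV[R]_n.+1) : x != 0 -> 0 < dotc x x.
Proof.
move=> x0; rewrite lt_def dotc_ge0 andbT; apply: contra x0.
rewrite dotcE psumr_eq0 => [/allP h|i _]; last by rewrite -expr2 sqr_ge0.
apply/eqP/colP => i; have := h i (mem_index_enum _).
by rewrite mulf_eq0 orbb mxE => /eqP.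
Qed.

(* For a complex eigenvector [u + i w] with eigenvalue [s + i t], symmetry of
   [P] gives [t (u . u + w . w) = 0]. *)
Lemma symmetric_eigenvector (P : 'M[R]_n.+1) : P^T = P ->
  exists s, exists2 x : 'cV[R]_n.+1, x != 0 & P *m x = s *: x.
Proof.
move=> PT.
have [z] := eigenvalue_closed (map_mx (real_complex R) P) (ltn0Sn n).
case: z => s t /eigenvalueP[v vP v0].
pose u : 'cV[R]_n.+1 := \col_i complex.Re (v 0 i).
pose w : 'cV[R]_n.+1 := \col_i complex.Im (v 0 i).
have ReD (x y : R[i]) : complex.Re (x + y) = complex.Re x + complex.Re y.
  by case: x y => [? ?] [].
have ImD (x y : R[i]) : complex.Im (x + y) = complex.Im x + complex.Im y.
  by case: x y => [? ?] [].
(* [v] is a left eigenvector; symmetry turns its real and imaginary parts into columns on which [P]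
   acts. *)
have Ps i j : P i j = P j i by rewrite -{1}PT mxE.
have Pu : P *m u = s *: u - t *: w.
  apply/colP => i; move/rowP: vP => /(_ i) /(congr1 (@complex.Re R)).
  rewrite !mxE (big_morph _ ReD (erefl : complex.Re (0 : R[i]) = 0)).
  case: (v 0 i) => /= p q <-; apply: eq_bigr => k _; rewrite !mxE.
  by case: (v 0 k) => c d /=; rewrite mulr0 subr0 mulrC Ps.
have Pw : P *m w = s *: w + t *: u.
  apply/colP => i; move/rowP: vP => /(_ i) /(congr1 (@complex.Im R)).
  rewrite !mxE (big_morph _ ImD (erefl : complex.Im (0 : R[i]) = 0)).
  case: (v 0 i) => /= p q <-; apply: eq_bigr => k _; rewrite !mxE.
  by case: (v 0 k) => c d /=; rewrite mulr0 add0r mulrC Ps.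
have uw : u != 0 \/ w != 0.
  apply/orP; rewrite -negb_and; apply: contra v0.
  move=> /andP[/eqP/colP u0 /eqP/colP w0].
  apply/eqP/rowP => i; have := u0 i; have := w0 i; rewrite !mxE.
  by case: (v 0 i) => ? ? /= -> ->.
have t0 : t = 0.
  have : dotc w (P *m u) = dotc u (P *m w) by rewrite dotc_mulmxr PT dotcC.
  rewrite Pu Pw dotcBr dotcDr !dotcZr (dotcC u w).
  move=> h; have {h} : t * (dotc u u + dotc w w) = 0 by lra.
  move/eqP; rewrite mulf_eq0 => /orP[/eqP//|].
  have := dotc_ge0 u; have := dotc_ge0 w.
  by case: uw => /dotc_gt0 h1 h2 h3 /eqP h4; lra.
case: uw => x0; exists s.
  by exists u => //; rewrite Pu t0 scale0r subr0.
by exists w => //; rewrite Pw t0 scale0r addr0.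
Qed.

Variable P : 'M[R]_n.+1.
Hypothesis P_posdef : posdefmx P.

Lemma posdef_eigen_gt0 (s : R) (x : 'cV[R]_n.+1) :
  x != 0 -> P *m x = s *: x -> 0 < s.
Proof.
move=> x0 Px; have := P_posdef.2 x x0.
by rewrite -mulmxA Px -/(dotc _ _) dotcZr pmulr_lgt0 // dotc_gt0.
Qed.

(* [P^T P - s^2 = (P + s) (P - s)] and [P + s] is injective. *)
Lemma singular_values_posdefE : singular_values P =
  [set s | exists2 x : 'cV[R]_n.+1, x != 0 & P *m x = s *: x].
Proof.
have PT := P_posdef.1; apply/seteqP; split=> s /=.
  move=> [s0 /eigenvalueP[v vP v0]]; exists v^T; first by rewrite trmx_eq0.
  pose y := P *m v^T - s *: v^T.
  have Py : P *m y = - s *: y.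
    have : P *m (P *m v^T) = s ^+ 2 *: v^T.
      move/(congr1 trmx): vP.
      by rewrite !trmx_mul trmxK PT linearZ /= -mulmxA.
    rewrite /y mulmxBr -scalemxAr => ->.
    by rewrite scaleNr scalerBr scalerA opprB expr2.
  apply/eqP; rewrite -subr_eq0 -/y; apply: contraT => y0.
  by have := posdef_eigen_gt0 y0 Py; rewrite oppr_gt0 ltNge s0.
move=> [x x0 Px]; split; first exact/ltW/posdef_eigen_gt0/Px.
apply/eigenvalueP; exists x^T; last by rewrite trmx_eq0.
apply: trmx_inj; rewrite trmx_mul trmxK trmx_mul !linearZ /= !trmxK PT.
by rewrite -mulmxA Px -scalemxAr Px scalerA expr2.
Qed.

(** Nonemptiness lets bounds on the eigenvalues pass to the [sup] and the [inf]. *)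
Lemma singular_values_neq0 : singular_values P !=set0.
Proof.
rewrite singular_values_posdefE.
have [s [x x0 Px]] := symmetric_eigenvector P_posdef.1.
by exists s; exists x.
Qed.

(** Read [P x = s x] in the row where [|x_i|] is largest: that maximum dominates every other
    coordinate and cancels. *)
Lemma sigma_max_le (c : R) : (forall i j, `|P i j| <= c) ->
  sigma_max P <= n.+1%:R * c.
Proof.
move=> Pc; apply: ge_sup; first exact: singular_values_neq0.
rewrite singular_values_posdefE => s /= [x x0 Px].
have s0 := posdef_eigen_gt0 x0 Px.
pose i := [arg max_(i > ord0 : 'I_n.+1) `|x i 0|]%O.
have imax j : `|x j 0| <= `|x i 0|.
  by rewrite /i; case: arg_maxP => // k _; apply.
have xi : 0 < `|x i 0|.
  rewrite normr_gt0; apply: contra x0 => /eqP xi0.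
  apply/eqP/colP => j; have := imax j.
  by rewrite xi0 normr0 normr_le0 mxE => /eqP.
rewrite -(ler_pM2r xi) -{1}(gtr0_norm s0) -normrM.
have -> : s * x i 0 = (P *m x) i 0 by rewrite Px mxE.
rewrite mxE (le_trans (ler_norm_sum _ _ _)) //.
apply: le_trans (_ : \sum_(j < n.+1) c * `|x i 0| <= _).
  by apply: ler_sum => j _; rewrite normrM ler_pM.
by rewrite sumr_const card_ord -[leLHS]mulr_natl mulrA.
Qed.

(** Each [|x_i x_j|] is at most [(x_i^2 + x_j^2) / 2], and summing over all pairs gives the factor
    [n + 1]. *)
Lemma quadratic_form_le (F : 'M[R]_n.+1) (f : R) (x : 'cV[R]_n.+1) :
  (forall i j, `|F i j| <= f) ->
  `|dotc x (F *m x)| <= n.+1%:R * f * dotc x x.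
Proof.
move=> Ff; have f0 : 0 <= f by apply: le_trans (Ff 0 0).
rewrite dotcE (le_trans (ler_norm_sum _ _ _)) //.
apply: le_trans (_ : \sum_(i < n.+1) \sum_(j < n.+1)
    f / 2 * (x i 0 ^+ 2 + x j 0 ^+ 2) <= _).
  apply: ler_sum => i _; rewrite mxE mulr_sumr.
  apply: le_trans (ler_norm_sum _ _ _) _.
  apply: ler_sum => j _; rewrite mulrCA normrM.
  apply: le_trans (_ : f * `|x i 0 * x j 0| <= _).
    by rewrite ler_wpM2r.
  rewrite -mulrA ler_wpM2l // normrM -(real_normK (num_real (x i 0))).
  rewrite -(real_normK (num_real (x j 0))).
  by have := sqr_ge0 (`|x i 0| - `|x j 0|); nra.
have dE : dotc x x = \sum_i x i 0 ^+ 2.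
  by rewrite dotcE; apply: eq_bigr => i _; rewrite expr2.
under eq_bigr => i _ do rewrite -mulr_sumr big_split /= sumr_const card_ord -dE.
rewrite -mulr_sumr big_split /= sumr_const card_ord sumrMnl -dE.
by rewrite le_eqVlt; apply/orP; left; apply/eqP; field.
Qed.

Lemma quadratic_lyapunov (F Q : 'M[R]_n.+1) (lambda s : R) (x : 'cV[R]_n.+1) :
  shifted_lyapunov F lambda Q -> Q^T = Q -> Q *m x = s *: x ->
  dotc x x = - 2 * s * (dotc x (F *m x) + lambda * dotc x x).
Proof.
move=> QF QT Qx.
have : dotc x ((F^T *m Q + Q *m F + (2 * lambda) *: Q) *m x) = - dotc x x.
  by rewrite QF mulNmx mul1mx -scaleN1r dotcZr mulN1r.
rewrite !mulmxDl -!mulmxA -scalemxAl Qx !dotcDr !dotcZr -scalemxAr dotcZr.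
rewrite (dotc_mulmxr Q) (dotc_mulmxr F^T) trmxK QT Qx (dotcC (s *: x)) dotcZr.
by rewrite (dotcC (F *m x)); lra.
Qed.

Lemma sigma_min_ge (F : 'M[R]_n.+1) (lambda f : R) :
  0 <= lambda -> 0 < f -> (forall i j, `|F i j| <= f) ->
  shifted_lyapunov F lambda P ->
  (2 * n.+1%:R * f)^-1 <= sigma_min P.
Proof.
move=> l0 f0 Ff PF; apply: lb_le_inf; first exact: singular_values_neq0.
rewrite singular_values_posdefE => s /= [x x0 Px].
have s0 := posdef_eigen_gt0 x0 Px; have xx := dotc_gt0 x0.
have e := quadratic_lyapunov PF P_posdef.1 Px.
have := quadratic_form_le x Ff; rewrite ler_norml => /andP[h _].
rewrite -div1r ler_pdivrMr; last by rewrite !mulr_gt0.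
rewrite -(ler_pM2r xx) mul1r {1}e.
set X := dotc x x in e xx h *; set Y := dotc x _ in e h *.
(* The shift by [lambda >= 0] has the favourable sign, so only the lower bound on [Y = x . F x]
   costs anything. *)
have : 0 <= s * (Y + n.+1%:R * f * X) + s * lambda * X.
  by rewrite addr_ge0 ?mulr_ge0 ?(ltW s0) ?(ltW xx) // -lerBlDr sub0r.
lra.
Qed.

End SingularValues.

(** * The Lyapunov equation in the eigenbasis *)

Section CauchyKernel.
Variables (R : realFieldType) (m : nat -> R).
Hypothesis m_gt0 : forall i, 0 < m i.

(** Scaled by [sqrt (2 m_k)], this is column [k] of the Cholesky factor of the matrix
    [1 / (m_i + m_j)]; it vanishes for [i < k]. *)
Definition ckern (k i : nat) : R :=
  \prod_(l < k) ((m i - m l) / (m i + m l)) / (m i + m k).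

(* Iterated Schur complements: eliminating index [k] from the kernel
   [1 / (m i + m j)] multiplies it by a factor [f_k(i) f_k(j)] with
   [f_k(i) = (m i - m k) / (m i + m k)]. *)
Lemma cauchy_kernel_expand (r i j : nat) :
  (m i + m j)^-1 = \sum_(k < r) 2 * m k * (ckern k i * ckern k j)
    + \prod_(l < r) ((m i - m l) / (m i + m l))
      * \prod_(l < r) ((m j - m l) / (m j + m l)) / (m i + m j).
Proof.
elim: r => [|r IH]; first by rewrite !big_ord0 !mul1r add0r.
rewrite {1}IH !big_ord_recr /= /ckern -addrA; congr (_ + _).
set p := \prod_(l < r) _; set q := \prod_(l < r) _.
have mi := m_gt0 i; have mj := m_gt0 j; have mr := m_gt0 r.
by field; rewrite !gt_eqF ?addr_gt0.
Qed.

(** After [n] eliminations the remainder contains the factor [m_i - m_i]. *)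
Lemma cauchy_kernel_squares (n : nat) (i j : 'I_n) :
  (m i + m j)^-1 = \sum_(k < n) 2 * m k * (ckern k i * ckern k j).
Proof.
rewrite (cauchy_kernel_expand n) [X in _ + X * _ / _](bigD1 i) //=.
by rewrite subrr !mul0r addr0.
Qed.

End CauchyKernel.

Section Lyapunov.
Variables (R : realType) (n : nat) (lambda : R) (mu : nat -> R).
Variables V W : 'M[R]_n.+1.
Hypotheses (VW : V *m W = 1%:M) (WV : W *m V = 1%:M).
Hypothesis mu_lt : forall i, mu i + lambda < 0.

Let F := V *m diag_mx (\row_i mu i) *m W.

Definition lyap_core : 'M[R]_n.+1 :=
  \matrix_(i, j) (- (V^T *m V) i j / (mu i + mu j + 2 * lambda)).

Definition lyap_sol : 'M[R]_n.+1 := W^T *m lyap_core *m W.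

Let m i := - (mu i + lambda).
Let m_gt0 i : 0 < m i. Proof. by rewrite oppr_gt0. Qed.

Let denE i j : mu i + mu j + 2 * lambda = - (m i + m j).
Proof. by rewrite /m; ring. Qed.

Let den_neq0 i j : mu i + mu j + 2 * lambda != 0.
Proof. by rewrite denE oppr_eq0 gt_eqF // addr_gt0. Qed.

(** In the eigenbasis the Lyapunov operator multiplies entry [(i, j)] by a scalar. *)
Lemma lyap_conj (P : 'M[R]_n.+1) : F^T *m P + P *m F + (2 * lambda) *: P
  = W^T *m (\matrix_(i, j) ((mu i + mu j + 2 * lambda) * (V^T *m P *m V) i j))
      *m W.
Proof.
have VWT : W^T *m V^T = 1%:M by rewrite -trmx_mul VW trmx1.
set D := diag_mx (\row_(i < n.+1) mu i).
have DT : D^T = D by rewrite /D tr_diag_mx.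
have -> : \matrix_(i, j) ((mu i + mu j + 2 * lambda) * (V^T *m P *m V) i j)
    = D *m (V^T *m P *m V) + V^T *m P *m V *m D
      + (2 * lambda) *: (V^T *m P *m V).
  apply/matrixP => i j.
  by rewrite mul_diag_mx mul_mx_diag !mxE; ring.
rewrite !mulmxDr !mulmxDl -scalemxAr -scalemxAl.
rewrite /F -/D !trmx_mul DT !mulmxA VWT mul1mx.
by rewrite -!(mulmxA _ V W) VW !mulmx1.
Qed.

(** These scalars are nonzero and the congruence by [V] is invertible, so [V^T P V] is forced entry
    by entry. *)
Lemma lyap_sol_unique : unique (shifted_lyapunov F lambda) lyap_sol.
Proof.
have WVT : V^T *m W^T = 1%:M by rewrite -trmx_mul WV trmx1.
have core : V^T *m lyap_sol *m V = lyap_core.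
  by rewrite /lyap_sol !mulmxA WVT mul1mx -mulmxA WV mulmx1.
have VWT : W^T *m V^T = 1%:M by rewrite -trmx_mul VW trmx1.
split=> [|P].
  rewrite /shifted_lyapunov lyap_conj core.
  have -> : \matrix_(i, j) ((mu i + mu j + 2 * lambda) * lyap_core i j)
      = - (V^T *m V).
    apply/matrixP => i j; rewrite [LHS]mxE [lyap_core i j]mxE mulrC divfK //.
    by rewrite [RHS]mxE.
  by rewrite mulmxN mulNmx !mulmxA VWT mul1mx VW.
rewrite /shifted_lyapunov lyap_conj => h.
have {}h : V^T *m P *m V = lyap_core.
  move: h => /(congr1 (fun X => V^T *m X *m V)).
  rewrite !mulmxA WVT mul1mx -mulmxA WV mulmx1 mulmxN mulmx1 mulNmx.
  move=> /matrixP h; apply/matrixP => i j; have := h i j.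
  rewrite [LHS]mxE => e.
  rewrite [RHS]mxE -[X in X / _](_ : (- (V^T *m V)) i j = _).
    by rewrite -e mulrC mulKf.
  by rewrite mxE.
rewrite /lyap_sol -h !mulmxA VWT mul1mx -mulmxA VW mulmx1 //.
Qed.

(** An entrywise product of the Gram matrix [V^T V] with the Cauchy kernel: each rank-one term of
    the kernel rescales the columns of [V] and leaves a Gram matrix. *)
Lemma lyap_core_squares : lyap_core = \sum_(k < n.+1)
  (2 * m k) *: ((V *m diag_mx (\row_i ckern m k i))^T
                 *m (V *m diag_mx (\row_i ckern m k i))).
Proof.
apply/matrixP => i j; rewrite mxE summxE denE invrN mulrNN.
rewrite (cauchy_kernel_squares m_gt0) mulr_sumr; apply: eq_bigr => k _.
rewrite trmx_mul tr_diag_mx mulmxA -(mulmxA _ V^T) mul_mx_diag.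
rewrite mul_diag_mx; set G := V^T *m V.
by rewrite !mxE; ring.
Qed.

Lemma lyap_sol_posdef : posdefmx lyap_sol.
Proof.
split.
  rewrite /lyap_sol !trmx_mul trmxK mulmxA; congr (_ *m _ *m _).
  apply/matrixP => i j; rewrite [LHS]mxE [LHS]mxE [RHS]mxE (addrC (mu j)).
  congr (- _ / _).
  by rewrite -[in RHS](trmxK (V^T *m V)) [in RHS]mxE trmx_mul trmxK.
move=> y y0; rewrite /lyap_sol !mulmxA -trmx_mul -mulmxA.
set x := W *m y.
have x0 : x != 0.
  apply: contra y0 => /eqP e.
  by rewrite -[y]mul1mx -VW -mulmxA -/x e mulmx0.
clearbody x; rewrite lyap_core_squares mulmx_sumr mulmx_suml summxE.
pose G (k : nat) := V *m diag_mx (\row_(i < n.+1) ckern m k i) *m x.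
have termE (k : 'I_n.+1) : (x^T *m ((2 * m k) *:
    ((V *m diag_mx (\row_i ckern m k i))^T
      *m (V *m diag_mx (\row_i ckern m k i))))
    *m x) 0 0 = 2 * m k * dotc (G k) (G k).
  rewrite -scalemxAr -scalemxAl mxE /dotc; congr (_ * _).
  by rewrite /G !trmx_mul !mulmxA.
(* The term [k = 0] alone gives strict positivity: [ckern m 0 i = 1 / (m_i + m_0)] never vanishes,
   so [G 0] is nonzero. *)
rewrite (eq_bigr _ (fun k _ => termE k)) big_ord_recl /=.
apply: ltr_wpDr.
  by apply: sumr_ge0 => k _; rewrite !mulr_ge0 ?dotc_ge0 // ltW.
rewrite !mulr_gt0 // dotc_gt0 //; apply: contra x0 => /eqP e.
have : W *m G 0%N = 0 by rewrite e mulmx0.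
rewrite /G !mulmxA WV mul1mx mul_diag_mx => /colP h.
apply/eqP/colP => i; have /eqP := h i; rewrite !mxE mulf_eq0 => /orP[|/eqP//].
by rewrite /ckern big_ord0 mul1r invr_eq0 gt_eqF // addr_gt0.
Qed.

End Lyapunov.

(** * Entrywise bounds *)

Lemma mulmx_entry_le (R : realFieldType) (m n p : nat) (A : 'M[R]_(m, n))
    (B : 'M[R]_(n, p)) (c d : R) :
  (forall i j, `|A i j| <= c) -> (forall i j, `|B i j| <= d) ->
  forall i j, `|(A *m B) i j| <= n%:R * (c * d).
Proof.
move=> Ac Bd i j; rewrite mxE (le_trans (ler_norm_sum _ _ _)) //.
apply: le_trans (_ : \sum_(k < n) c * d <= _).
  by apply: ler_sum => k _; rewrite normrM ler_pM.
by rewrite sumr_const card_ord mulr_natl.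
Qed.

Lemma prod_norm_le (R : realFieldType) (I : finType) (Q : pred I) (F : I -> R)
    (c : R) : 1 <= c -> (forall i, `|F i| <= c) ->
  `|\prod_(i | Q i) F i| <= c ^+ #|I|.
Proof.
move=> c1 Fc; rewrite normr_prod.
apply: le_trans (_ : \prod_(i | Q i) c <= _).
  by apply: ler_prod => i _; rewrite normr_ge0 Fc.
by rewrite prodr_const ler_weXn2l // max_card.
Qed.

Lemma prod_norm_ge1 (R : realFieldType) (I : finType) (Q : pred I)
    (F : I -> R) :
  (forall i, Q i -> 1 <= `|F i|) -> 1 <= `|\prod_(i | Q i) F i|.
Proof.
move=> F1; rewrite normr_prod; elim/big_ind: _ => // x y x1 y1.
by rewrite -[1]mulr1 ler_pM.
Qed.

Section CauchyBounds.
Variables (R : realFieldType) (n : nat) (a mu b : nat -> R) (X : R).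
Hypothesis X_ge1 : 1 <= X.
Hypothesis a_sep : forall i j, i != j -> 1 <= `|a i - a j|.
Hypothesis mu_sep : forall i j, i != j -> 1 <= `|mu i - mu j|.
Hypothesis mu_a_ge1 : forall i j : 'I_n.+1, 1 <= `|mu j - a i|.
Hypothesis mu_a_leX : forall i j : 'I_n.+1, `|mu j - a i| <= X.
Hypothesis b_le1 : forall i : 'I_n.+1, `|b i| <= 1.
Hypothesis b_ge : forall i : 'I_n.+1, X^-1 <= `|b i|.

Lemma cauchy_mx_le (i j : 'I_n.+1) : `|cauchy_mx n a mu b i j| <= 1.
Proof.
rewrite mxE normrM normfV ler_pdivrMr ?mul1r; last first.
  by rewrite (lt_le_trans ltr01).
exact: le_trans (b_le1 i) (mu_a_ge1 i j).
Qed.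

(** The node product and the Lagrange product each cost [X ^ (n + 1)], and [1 / b_i] costs one more
    [X]; the separation of the [a_i] makes the remaining denominator harmless. *)
Lemma cauchy_inv_le (i j : 'I_n.+1) :
  `|cauchy_inv n a mu b j i| <= X ^+ (2 * n.+1).+1.
Proof.
have X0 : 0 < X by apply: lt_le_trans X_ge1.
rewrite mxE !normrM exprSr mul2n -addnn exprD !normfV.
have h1 : `|\prod_(k < n.+1) (mu j - a k)| <= X ^+ n.+1.
  by rewrite -[in X in _ <= X](card_ord n.+1) prod_norm_le.
have h2 : `|\prod_(l < n.+1 | l != j) ((a i - mu l) / (mu j - mu l))|
    <= X ^+ n.+1.
  rewrite -[in X in _ <= X](card_ord n.+1).
  (* Putting 1 at the excluded index leaves only denominators covered by [mu_sep]. *)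
  rewrite big_mkcond prod_norm_le // => l.
  case: ifP => // lj; last by rewrite normr1.
  rewrite normrM normfV distrC ler_pdivrMr.
    apply: le_trans (mu_a_leX _ _) _; rewrite ler_peMr ?(ltW X0) //.
    by apply: mu_sep; rewrite eq_sym.
  by rewrite (lt_le_trans ltr01) // mu_sep // eq_sym.
have h3 : 1 <= `|\prod_(k < n.+1 | k != i) (a i - a k)|.
  by apply: prod_norm_ge1 => k ki; rewrite a_sep // eq_sym.
have b0 : 0 < `|b i| by rewrite (lt_le_trans _ (b_ge i)) // invr_gt0.
rewrite ler_pM ?mulr_ge0 ?invr_ge0 //.
  rewrite -[X in _ <= X]mulr1 ler_pM ?mulr_ge0 ?invr_ge0 //.
    by rewrite ler_pM.
  by rewrite invf_le1 // (lt_le_trans ltr01).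
by rewrite -[X]invrK lef_pV2 // posrE ?invr_gt0.
Qed.

End CauchyBounds.

Section LyapunovBounds.
Variables (R : realType) (n : nat) (lambda : R) (mu : nat -> R).
Variables (V W : 'M[R]_n.+1) (X w : R).
Hypotheses (VW : V *m W = 1%:M) (WV : W *m V = 1%:M).
Hypotheses (lambda_ge0 : 0 <= lambda) (X_ge2 : 2 <= X) (nX : n.+1%:R <= X).
Hypothesis w_gt0 : 0 < w.
Hypothesis mu_lt : forall i, 1 <= - (mu i + lambda).
Hypothesis mu_leX : forall i : 'I_n.+1, `|mu i| <= X.
Hypothesis V_le1 : forall i j, `|V i j| <= 1.
Hypothesis W_lew : forall i j, `|W i j| <= w.

Let X_gt0 : 0 < X. Proof. by apply: lt_le_trans X_ge2. Qed.

Let mu_lt0 i : mu i + lambda < 0.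
Proof. by have := mu_lt i; lra. Qed.

(** One [X] bounds the entries of the core, and each of the two products with [W] costs [n + 1 <= X]
    and a factor [w]. *)
Lemma lyap_sol_le i j : `|lyap_sol lambda mu V W i j| <= X ^+ 3 * w ^+ 2.
Proof.
have n0 : 0 <= n.+1%:R :> R by [].
have core k l : `|lyap_core lambda mu V k l| <= X.
  rewrite mxE normrM normrN normfV.
  have VV : `|(V^T *m V) k l| <= X.
    apply: le_trans (mulmx_entry_le (c := 1) (d := 1) _ _ k l) _ => //.
      by move=> p q; rewrite mxE.
    by rewrite !mulr1.
  rewrite ler_pdivrMr; first last.
    by rewrite normr_gt0; have := mu_lt k; have := mu_lt l; lra.
  apply: le_trans VV _; rewrite ler_peMr ?(ltW X_gt0) // ler0_norm.
    by have := mu_lt k; have := mu_lt l; lra.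
  by have := mu_lt k; have := mu_lt l; lra.
have WT k l : `|W^T k l| <= w by rewrite mxE.
apply: le_trans (mulmx_entry_le (mulmx_entry_le WT core) W_lew i j) _.
apply: le_trans (_ : X * (X * (w * X) * w) <= _).
  have w0 := ltW w_gt0; have X0 := ltW X_gt0.
  rewrite ler_pM ?mulr_ge0 // ler_wpM2r // ler_wpM2r ?mulr_ge0 //.
by rewrite le_eqVlt; apply/orP; left; apply/eqP; ring.
Qed.

Let F := V *m diag_mx (\row_i mu i) *m W.

Lemma lyap_sol_sigma_max :
  sigma_max (lyap_sol lambda mu V W) <= X ^+ 4 * w ^+ 2.
Proof.
apply: le_trans (sigma_max_le (lyap_sol_posdef VW WV mu_lt0) lyap_sol_le) _.
rewrite [X ^+ 4]exprS -[leRHS]mulrA ler_wpM2r //.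
by rewrite mulr_ge0 // exprn_ge0 // ltW.
Qed.

Lemma lyap_sol_sigma_min :
  (X ^+ 4 * w)^-1 <= sigma_min (lyap_sol lambda mu V W).
Proof.
have FX i j : `|F i j| <= X * (X * w).
  apply: le_trans (mulmx_entry_le (c := X) _ W_lew i j) _.
    move=> p q; rewrite mul_mx_diag !mxE normrM -[X]mul1r.
    by rewrite ler_pM.
  by rewrite ler_wpM2r // mulr_ge0 // ltW.
have f0 : 0 < X * (X * w) by rewrite !mulr_gt0.
apply: le_trans (sigma_min_ge (lyap_sol_posdef VW WV mu_lt0) lambda_ge0 f0 FX
  (lyap_sol_unique VW WV mu_lt0).1).
rewrite lef_pV2 ?posrE ?mulr_gt0 ?exprn_gt0 //.
(* Two of the factors [X] absorb 2 and [n + 1]. *)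
have -> : X ^+ 4 * w = X * X * (X * (X * w)) by ring.
by rewrite ler_wpM2r ?(ltW f0) // ler_pM.
Qed.

End LyapunovBounds.

(** * The spectral data of the truncated system *)

Section SpectralData.
Variables (R : realType) (lambda : R).
Hypothesis lambda_gt : 2 * pi ^+ 2 < lambda.

(** The diagonal of [A0] is extended to all of [nat], so that it is an injective sequence as the
    interpolation lemmas require. *)
Definition acoef (i : nat) : R :=
  if i == 0%N then 1 - pi ^+ 2 / 4 else 1 - lam R i.

Definition bcoef0 (i : nat) : R := if i == 0%N then 1 else bcoef R i.

Local Notation N := (dimN lambda).

Let pi4 : 4 <= pi ^+ 2 :> R.
Proof. by have := pi_ge2 R; nra. Qed.

Lemma lambda_gt8 : 8 < lambda.
Proof. by have := pi4; have := lambda_gt; lra. Qed.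

Let lambda8 : 8 < lambda.
Proof. exact: lambda_gt8. Qed.

(** Controls [N] itself, the lowest value of [acoef] and, through [i pi <= N pi], the decay of
    [bcoef]. *)
Lemma dimN_pi_sqr_le : (N%:R * pi) ^+ 2 <= 2 * lambda + 1.
Proof.
have p0 := pi_gt0 R.
have l0 : 0 <= 2 * lambda + 1 by have := lambda8; lra.
rewrite -[leRHS]sqr_sqrtr // ler_sqr ?nnegrE ?mulr_ge0 ?sqrtr_ge0 ?(ltW p0) //.
by rewrite -ler_pdivlMr // truncn_le divr_ge0 ?sqrtr_ge0 // ltW.
Qed.

Lemma dimN_gt0 : (0 < N)%N.
Proof.
have p0 := pi_gt0 R.
rewrite truncn_ge_nat ?divr_ge0 ?sqrtr_ge0 ?(ltW p0) //.
rewrite ler_pdivlMr // mul1r -[pi]gtr0_norm // -sqrtr_sqr ler_sqrt.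
  by have := lambda_gt; have := pi4; lra.
by have := lambda8; lra.
Qed.

Lemma dimN_sqr_le : N%:R ^+ 2 <= lambda.
Proof.
have := dimN_pi_sqr_le; rewrite exprMn => h.
have : N%:R ^+ 2 * 4 <= N%:R ^+ 2 * pi ^+ 2 :> R by rewrite ler_wpM2l ?sqr_ge0.
by have := lambda8; lra.
Qed.

Lemma dimN_le_sqrt : N%:R <= Num.sqrt lambda.
Proof.
rewrite -[N%:R]ger0_norm // -sqrtr_sqr ler_sqrt ?dimN_sqr_le //.
by have := lambda8; lra.
Qed.

Lemma dimN_ge1 : 1 <= N%:R :> R.
Proof. by rewrite (ler_nat R 1) dimN_gt0. Qed.

Lemma dimN_le_lambda : N%:R <= lambda.
Proof. by have := dimN_sqr_le; have := dimN_ge1; nra. Qed.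

(** For [i < j] the gap is [(j^2 - i^2) pi^2], or [(j^2 - 1/4) pi^2] when [i = 0]; both are at least
    3 because [pi^2 >= 4]. *)
Lemma acoef_sep i j : i != j -> 1 <= `|acoef i - acoef j|.
Proof.
wlog ij : i j / (i < j)%N => [hw ne|_].
  have [?|?|e] := ltngtP i j; first exact: hw.
    by rewrite distrC; apply: hw => //; rewrite eq_sym.
  by rewrite e eqxx in ne.
rewrite (le_trans _ (ler_norm _)) // /acoef /lam (gtn_eqF (leq_trans _ ij)) //.
have : (i.+1%:R <= j%:R :> R) by rewrite ler_nat.
have p4 := pi4; rewrite -natr1; case: eqP => [->|_] h; rewrite exprMn.
  have : 1 <= j%:R ^+ 2 :> R by nra.
  by nra.
have i0 : 0 <= i%:R :> R by [].
have : 1 <= j%:R ^+ 2 - i%:R ^+ 2 :> R by nra.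
by rewrite exprMn; nra.
Qed.

Lemma acoef_bounds i : (i <= N)%N -> -2 * lambda <= acoef i <= 1.
Proof.
move=> iN; have h := dimN_pi_sqr_le; have n1 := dimN_ge1.
have p4 := pi4; have l8 := lambda8.
have {}iN : i%:R <= N%:R :> R by rewrite ler_nat.
rewrite exprMn in h; have i0 : 0 <= i%:R :> R by [].
have n2 : 1 <= N%:R ^+ 2 :> R by nra.
have np : 0 <= (N%:R ^+ 2 - 1) * pi ^+ 2 :> R.
  by rewrite mulr_ge0 ?sqr_ge0 //; lra.
rewrite /acoef /lam; case: eqP => _; first by lra.
rewrite exprMn; have : i%:R ^+ 2 <= N%:R ^+ 2 :> R by nra.
have : 0 <= i%:R ^+ 2 :> R by rewrite sqr_ge0.
move=> i2 iN2.
have : i%:R ^+ 2 * pi ^+ 2 <= N%:R ^+ 2 * pi ^+ 2 :> R.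
  by rewrite ler_wpM2r ?sqr_ge0.
have : 0 <= i%:R ^+ 2 * pi ^+ 2 :> R by rewrite mulr_ge0 ?sqr_ge0.
by lra.
Qed.

(** Above, [4 sqrt 2 i <= 6 i <= 2 (4 i^2 - 1)], with equality on the right at [i = 1]; below,
    [|b_i|] decays only like [1 / i]. *)
Lemma bcoef0_bounds i : (i <= N)%N ->
  (5 * lambda)^-1 <= `|bcoef0 i| /\ `|bcoef0 i| <= 1.
Proof.
move=> iN; have l0 := lambda8; rewrite /bcoef0; case: eqP => [_|/eqP].
  by rewrite normr1 lexx; split => //; rewrite invf_le1; lra.
rewrite -lt0n => i0; rewrite /bcoef.
have p2 := pi_ge2 R.
have s2 : Num.sqrt 2 ^+ 2 = 2 :> R by rewrite sqr_sqrtr.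
have s0 : 0 <= Num.sqrt 2 :> R by rewrite sqrtr_ge0.
have s1 : 1 <= Num.sqrt 2 :> R by nra.
have s3 : Num.sqrt 2 <= 3 / 2 :> R by nra.
have i1 : 1 <= i%:R :> R by rewrite (ler_nat R 1).
have i2 : 1 <= i%:R ^+ 2 :> R by nra.
have d0 : 0 < (4 * i%:R ^+ 2 - 1) * pi :> R by rewrite mulr_gt0 ?pi_gt0 //; lra.
have n0 : 0 < 4 * Num.sqrt 2 * i%:R :> R by rewrite !mulr_gt0 //; lra.
rewrite normrM normrN normfV !gtr0_norm //; split.
  rewrite ler_pdivlMr // mulrC ler_pdivrMr; last by lra.
  have ip : (i%:R * pi) ^+ 2 <= 2 * lambda + 1 :> R.
    apply: le_trans dimN_pi_sqr_le.
    rewrite ler_sqr ?nnegrE ?mulr_ge0 ?pi_ge0 //.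
    by rewrite ler_wpM2r ?pi_ge0 // ler_nat.
  have {}ip : i%:R * pi <= 5 * lambda :> R by nra.
  apply: le_trans (_ : 4 * i%:R * (i%:R * pi) <= _); first by nra.
  apply: le_trans (_ : 4 * i%:R * (5 * lambda) <= _).
    by rewrite ler_wpM2l // mulr_ge0.
  by rewrite ler_wpM2r //; nra.
rewrite ler_pdivrMr // mul1r.
apply: le_trans (_ : 6 * i%:R <= _); first by nra.
apply: le_trans (_ : (4 * i%:R ^+ 2 - 1) * 2 <= _); first by nra.
by rewrite ler_wpM2l //; lra.
Qed.

Let c : R := (Num.floor lambda)%:~R / N%:R.

(** [N] is an integer below [lambda], hence below its floor. *)
Lemma lamhat_step_ge1 : 1 <= c.
Proof.
have n1 := dimN_ge1.
rewrite ler_pdivlMr; last by lra.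
rewrite mul1r -[N%:R]/((Posz N)%:~R) ler_int floor_ge_int.
exact: dimN_le_lambda.
Qed.

Lemma lamhat_step_le : c * N%:R <= lambda.
Proof.
have n1 := dimN_ge1.
by rewrite divfK ?floor_le //; lra.
Qed.

Lemma lamhat_sep i j : i != j -> 1 <= `|lamhat lambda i - lamhat lambda j|.
Proof.
wlog ij : i j / (i < j)%N => [hw ne|_].
  have [?|?|e] := ltngtP i j; first exact: hw.
    by rewrite distrC; apply: hw => //; rewrite eq_sym.
  by rewrite e eqxx in ne.
rewrite (le_trans _ (ler_norm _)) // /lamhat -/c.
have : (i.+1%:R <= j%:R :> R) by rewrite ler_nat.
by rewrite -natr1; have := lamhat_step_ge1; nra.
Qed.

Lemma lamhat_le i : lamhat lambda i <= -3 * lambda.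
Proof.
rewrite /lamhat -/c; have := lamhat_step_ge1 => c1.
have : 0 <= c * i%:R by rewrite mulr_ge0 //; lra.
by lra.
Qed.

Lemma lamhat_ge i : (i <= N)%N -> -4 * lambda <= lamhat lambda i.
Proof.
rewrite -(ler_nat R) /lamhat -/c => iN.
have := lamhat_step_ge1 => c1; have := lamhat_step_le => c2.
have : c * i%:R <= c * N%:R by rewrite ler_wpM2l //; lra.
by lra.
Qed.

(** As [lambda > 8], [5 lambda <= lambda^2]; then [N <= sqrt lambda] turns the power into the
    exponential. *)
Lemma power_le_expR (e D : nat) : (e <= D * N)%N ->
  (5 * lambda) ^+ e <= expR (2 * D%:R * Num.sqrt lambda * ln lambda).
Proof.
move=> DN; have l0 := lambda8.
apply: le_trans (_ : (lambda ^+ 2) ^+ e <= _).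
  by rewrite lerXn2r ?nnegrE ?sqr_ge0 //; [lra|nra].
apply: le_trans (_ : (lambda ^+ 2) ^+ (D * N) <= _).
  by rewrite ler_weXn2l //; nra.
have -> : (lambda ^+ 2) ^+ (D * N) = expR (2 * D%:R * N%:R * ln lambda).
  rewrite -exprM -{1}[lambda]lnK ?posrE; last by lra.
  by rewrite -expRM_natl !natrM !mulrA.
rewrite ler_expR ler_wpM2r //; first by rewrite ln_ge0 //; lra.
by rewrite ler_wpM2l ?dimN_le_sqrt // mulr_ge0.
Qed.

End SpectralData.

(** * Assembly of the bounds with explicit constants *)

Lemma sep_injective (R : realFieldType) (f : nat -> R) :
  (forall i j, i != j -> 1 <= `|f i - f j|) -> injective f.
Proof.
move=> sep i j fij; apply/eqP; apply: contraT => /sep.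
by rewrite fij subrr normr0 ler10.
Qed.

Theorem proposition3p2 (R : realType) :
  exists D1 D2 : R, 1 < D1 /\ 1 < D2 /\
    forall lambda : R, 2 * pi ^+ 2 < lambda ->
      exists P : 'M[R]_((dimN lambda).+1),
        [/\ unique (shifted_lyapunov (F0 lambda) lambda) P,
            posdefmx P,
            sigma_max P <= expR (D1 * Num.sqrt lambda * ln lambda)
          & expR (- (D2 * Num.sqrt lambda * ln lambda)) <= sigma_min P].
Proof.
(* The exponent of [X] in [X^4 w^2] is [4 N + 10 <= 14 N], as [N >= 1]; the 2 comes from
   [5 lambda <= lambda^2]. *)
exists (2 * 14%:R), (2 * 14%:R); split; [lra|split; [lra|]] => lambda hl.
have l8 := lambda_gt8 hl.
set N := dimN lambda.
have N1 : (0 < N)%N by apply: dimN_gt0.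
pose X := 5 * lambda; pose w := X ^+ (2 * N.+1).+1.
have X2 : 2 <= X by rewrite /X; lra.
have X1 : 1 <= X by lra.
have X0 : 0 < X by lra.
have w0 : 0 < w by rewrite exprn_gt0.
pose mu := lamhat lambda; pose a := @acoef R; pose b := @bcoef0 R.
have iN (i : 'I_N.+1) : (i <= N)%N by rewrite -ltnS.
have a_sep := @acoef_sep R.
have mu_sep := lamhat_sep hl.
(* The [mu_j] lie in [[-4 lambda, -3 lambda]] and the [a_i] in [[-2 lambda, 1]]. *)
have mu_a (i j : 'I_N.+1) : 1 <= `|mu j - a i| /\ `|mu j - a i| <= X.
  have /andP[a1 a2] := acoef_bounds hl (iN i).
  have m1 := lamhat_le hl j; have m2 := lamhat_ge hl (iN j).
  rewrite ler0_norm /mu /a /X; first by split; lra.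
  by lra.
have mu_neq_a (i j : 'I_N.+1) : mu j != a i.
  rewrite -subr_eq0 -normr_gt0; have [h _] := mu_a i j.
  by apply: lt_le_trans h.
have b1 (i : 'I_N.+1) : `|b i| <= 1 by have [_] := bcoef0_bounds hl (iN i).
have bX (i : 'I_N.+1) : X^-1 <= `|b i| by have [] := bcoef0_bounds hl (iN i).
have b0 (i : 'I_N.+1) : b i != 0.
  by rewrite -normr_gt0 (lt_le_trans _ (bX i)) // invr_gt0.
have a_inj : injective a by apply: sep_injective.
have mu_inj : injective mu by apply: sep_injective.
pose V := cauchy_mx N a mu b; pose W := cauchy_inv N a mu b.
have VW : V *m W = 1%:M by apply: cauchy_mxV.
have WV : W *m V = 1%:M by apply: cauchy_invV.
have V1 i j : `|V i j| <= 1.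
  by apply: cauchy_mx_le => // k l; have [] := mu_a k l.
have Ww i j : `|W i j| <= w.
  by apply: cauchy_inv_le => // k l; have [] := mu_a k l.
have muX (i : 'I_N.+1) : `|mu i| <= X.
  have m1 := lamhat_le hl i; have m2 := lamhat_ge hl (iN i).
  by rewrite ler_norml /mu /X; apply/andP; split; lra.
have mu_lt i : 1 <= - (mu i + lambda).
  by have := lamhat_le hl i; rewrite /mu; lra.
have mu_lt0 i : mu i + lambda < 0 by have := mu_lt i; lra.
have l0 : 0 <= lambda by lra.
have NX : N.+1%:R <= X.
  by rewrite -natr1 /X; have := dimN_le_lambda hl; rewrite -/N; lra.
have FE : F0 lambda = V *m diag_mx (\row_i mu i) *m W.
  exact: ackermann_diagonalises.
have e14 : ((2 * N.+1).+1 * 2 + 4 <= 14 * N)%N by lia.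
have := power_le_expR hl e14; rewrite -/X exprD exprM -/w mulrC => hX.
exists (lyap_sol lambda mu V W); split.
- by rewrite FE; apply: lyap_sol_unique.
- exact: lyap_sol_posdef.
- exact: le_trans (lyap_sol_sigma_max VW WV X2 NX w0 mu_lt V1 Ww) hX.
- apply: le_trans _ (lyap_sol_sigma_min VW WV l0 X2 NX w0 mu_lt muX V1 Ww).
  (* As [w >= 1], the bound on [X^4 w^2] also covers [X^4 w]. *)
  have w1 : 1 <= w by exact: exprn_ege1.
  have X4 : 0 < X ^+ 4 by exact: exprn_gt0.
  rewrite expRN lef_pV2 ?posrE ?expR_gt0 ?(mulr_gt0 X4 w0) //.
  apply: le_trans _ hX; rewrite ler_wpM2l ?(ltW X4) //.
  by rewrite expr2 ler_peMr // (ltW w0).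
Qed.
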